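(* Let $C$ be a simple closed contour with bounded interior $\mathcal{D}^+$ and exterior $\mathcal{D}^-$, and let $f$ be a generalized Cauchy function with respect to $C$. If $f$ satisfies $$\frac{1}{2\pi i}\oint_C \frac{f(t)}{t-z}\,dt = f(z)\quad (z\in\mathcal{D}^+)\qquad\text{and also}\qquad \frac{1}{2\pi i}\oint_C \frac{f(t)}{t-z}\,dt = 0\quad (z\in\mathcal{D}^-),$$ then $f$ is uniformly continuous in the closed domain $\overline{\mathcal{D}^+}=\mathcal{D}^+\cup C$.
   Context: $C$ is a simple closed regular (smooth) curve in the complex plane, traversed counterclockwise; $\mathcal{D}^+$ is the simply connected open domain bounded by $C$, and $\mathcal{D}^-$ is the open domain outside $C$. A generalized Cauchy function with respect to $C$ is a single-valued function $f$ of the complex variable $z$ that is $n$ times continuously (complex) differentiable in $\mathcal{D}^+$ and in a neighborhood of $C$ (a neighborhood striding across $C$), for some $n\ge 1$, $n$ being arbitrary. *)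

(* Defs.v *)
From Stdlib Require Export Reals.
From Coquelicot Require Export Coquelicot.
Open Scope R_scope.

(** A closed curve is given by a [T]-periodic map [gamma : R -> C]; one period
    [0, T] traverses it once.  Periodicity makes the smoothness hypotheses
    apply at the base point as well. *)

Definition velocity (gamma : R -> C) (t : R) : C :=
  (Derive (fun s => fst (gamma s)) t, Derive (fun s => snd (gamma s)) t).

Record smooth_simple_closed_curve (T : R) (gamma : R -> C) : Prop := {
  curve_period_pos : 0 < T;
  curve_periodic : forall t : R, gamma (t + T) = gamma t;
  curve_simple : forall s t : R,
    0 <= s < T -> 0 <= t < T -> gamma s = gamma t -> s = t;
  curve_derivable : forall t : R, ex_derive (V := C_R_NormedModule) gamma t;
  curve_C1 : forall t : R,
    continuous (U := C_UniformSpace) (velocity gamma) t;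
  curve_regular : forall t : R, velocity gamma t <> RtoC 0
}.

Definition on_curve (gamma : R -> C) (z : C) : Prop :=
  exists t : R, gamma t = z.

Definition bounded_set (A : C -> Prop) : Prop :=
  exists M : R, forall z : C, A z -> Cmod z <= M.

Definition connected_set (A : C -> Prop) : Prop :=
  forall U V : C -> Prop,
    open (T := C_UniformSpace) U -> open (T := C_UniformSpace) V ->
    (forall z : C, A z -> U z \/ V z) ->
    (forall z : C, A z -> ~ (U z /\ V z)) ->
    (forall z : C, A z -> U z) \/ (forall z : C, A z -> V z).

Definition component (S : C -> Prop) (z w : C) : Prop :=
  exists A : C -> Prop,
    connected_set A /\ (forall u : C, A u -> S u) /\ A z /\ A w.

(** The interior (resp. exterior) of the curve consists of the bounded
    (resp. unbounded) components of its complement; by the Jordan curve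
    theorem there is exactly one of each. *)

Definition off_curve (gamma : R -> C) (z : C) : Prop := ~ on_curve gamma z.

Definition curve_interior (gamma : R -> C) (z : C) : Prop :=
  off_curve gamma z /\ bounded_set (component (off_curve gamma) z).

Definition curve_exterior (gamma : R -> C) (z : C) : Prop :=
  off_curve gamma z /\ ~ bounded_set (component (off_curve gamma) z).

(** Along one period, a continuous determination [theta] of
    [arg (gamma t - z)] increases by [2 PI], for every interior [z]. *)

Definition counterclockwise (T : R) (gamma : R -> C) : Prop :=
  forall z : C, curve_interior gamma z ->
    exists theta : R -> R,
      (forall t : R, continuous theta t) /\
      (forall t : R,
         Cminus (gamma t) z =
         Cmult (RtoC (Cmod (Cminus (gamma t) z)))
               (cos (theta t), sin (theta t))) /\
      theta T = theta 0 + 2 * PI.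

Definition contour_integral (T : R) (gamma : R -> C) (h : C -> C) : C :=
  RInt (V := C_R_CompleteNormedModule)
    (fun t => Cmult (h (gamma t)) (velocity gamma t)) 0 T.

Definition cauchy_integral (T : R) (gamma : R -> C) (f : C -> C) (z : C) : C :=
  Cmult (Cinv (Cmult (RtoC (2 * PI)) Ci))
        (contour_integral T gamma (fun t => Cdiv (f t) (Cminus t z))).

(** [g k] is the [k]-th complex derivative of [f] on [U], for [k <= n];
    [is_derive] over [C_AbsRing] is complex differentiability. *)

Definition n_times_cont_C_diff_on (n : nat) (f : C -> C) (U : C -> Prop)
  : Prop :=
  exists g : nat -> C -> C,
    (forall z : C, g O z = f z) /\
    (forall (k : nat) (z : C), (k < n)%nat -> U z ->
       is_derive (K := C_AbsRing) (V := C_NormedModule)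
         (g k) z (g (S k) z)) /\
    (forall z : C, U z ->
       continuous (T := C_UniformSpace) (U := C_UniformSpace) (g n) z).

(** On the values of [f] outside the interior and the neighbourhood [N] of
    the curve nothing is assumed. *)

Definition generalized_cauchy_function (gamma : R -> C) (f : C -> C) : Prop :=
  exists (n : nat) (N : C -> Prop),
    (1 <= n)%nat /\
    open (T := C_UniformSpace) N /\
    (forall z : C, on_curve gamma z -> N z) /\
    n_times_cont_C_diff_on n f (fun z => curve_interior gamma z \/ N z).

Definition uniformly_continuous_on (A : C -> Prop) (f : C -> C) : Prop :=
  forall eps : R, 0 < eps ->
    exists delta : R, 0 < delta /\
      forall z w : C, A z -> A w ->
        Cmod (Cminus z w) < delta -> Cmod (Cminus (f z) (f w)) < eps.

(* Main.v *)
Require Import Defs.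
From Stdlib Require Import Reals Lra ClassicalEpsilon.
From Coquelicot Require Import Coquelicot.

(** This is an instance of the Heine-Cantor theorem.  A generalized Cauchy
    function is complex differentiable, hence continuous, at every point of the
    interior and, thanks to the neighbourhood straddling the curve, also at
    every point of the curve ([generalized_cauchy_continuous]).  It remains to
    see that the interior together with the curve is compact; both halves of this
    come from the definition of the interior by bounded components.

    Boundedness ([interior_or_curve_bounded]): the curve lies in some disc, and
    a point [z] outside that disc is joined to infinity by the ray [r z],
    [r >= 1], so its component is unbounded.

    Closedness ([interior_or_curve_closed]): the curve is a compact set, so a
    point of the complement that is off the curve is the centre of a disc
    avoiding it.  The disc is connected, so all its points share the component
    of the centre, and none is interior if the centre is not.

    Both arguments rest on the connectedness of star-shaped sets
    ([star_shaped_connected]), a consequence of the least upper bound principle on a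
    segment.  The Heine-Cantor argument itself ([Heine_Cmod]) applies a
    Lebesgue-number lemma for gauges on a rectangle containing the set. *)

(** * Discs and continuity in terms of the modulus *)

Lemma Cmod_le_components (x y : R) : Cmod (x, y) <= Rabs x + Rabs y.
Proof.
unfold Cmod; simpl fst; simpl snd.
pose proof (Rabs_pos x); pose proof (Rabs_pos y).
rewrite <- (sqrt_Rsqr (Rabs x + Rabs y)) by lra.
apply sqrt_le_1_alt.
rewrite <- (pow2_abs x), <- (pow2_abs y). unfold Rsqr. nra.
Qed.

Lemma Cmod_component_lt (z : C) (r : R) :
  Cmod z < r -> Rabs (fst z) < r /\ Rabs (snd z) < r.
Proof.
intros Hz; pose proof (Rmax_Cmod z) as H.
pose proof (Rmax_l (Rabs (fst z)) (Rabs (snd z))).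
pose proof (Rmax_r (Rabs (fst z)) (Rabs (snd z))).
split; lra.
Qed.

Lemma Cmod_minus_triangle (a b c : C) :
  Cmod (a - c) <= Cmod (a - b) + Cmod (b - c).
Proof.
replace (a - c)%C with ((a - b) + (b - c))%C by ring.
apply Cmod_triangle.
Qed.

Lemma Cmod_minus_sym (a b : C) : Cmod (a - b) = Cmod (b - a).
Proof. rewrite <- Cmod_opp; f_equal; ring. Qed.

Lemma Cmod_minus_diag (a : C) : Cmod (a - a) = 0.
Proof. replace (a - a)%C with (RtoC 0) by ring; apply Cmod_0. Qed.

Lemma open_disc (U : C -> Prop) (z : C) :
  open (T := C_UniformSpace) U -> U z ->
  exists r : R, 0 < r /\ forall w : C, Cmod (w - z) < r -> U w.
Proof.
intros HU Hz; destruct (HU z Hz) as [r Hr].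
exists r; split; [apply cond_pos | intros w Hw].
apply Hr; apply Cmod_component_lt in Hw; exact Hw.
Qed.

(** The balls of the product uniform structure on [C] are squares; halving the
    side puts them inside a round disc. *)
Lemma ball_half_Cmod (z w : C) (eps : R) :
  ball (M := C_UniformSpace) z (eps / 2) w -> Cmod (w - z) < eps.
Proof.
intros [Hx Hy].
change (Rabs (fst w - fst z) < eps / 2) in Hx.
change (Rabs (snd w - snd z) < eps / 2) in Hy.
eapply Rle_lt_trans; [apply Cmod_le_components |].
simpl; unfold Rminus in *; lra.
Qed.

Lemma C_derivable_continuous (g : C -> C) (p l : C) :
  is_derive (K := C_AbsRing) (V := C_NormedModule) g p l ->
  forall eps : R, 0 < eps ->
  exists r : R, 0 < r /\
    forall w : C, Cmod (w - p) < r -> Cmod (g w - g p) < eps.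
Proof.
intros Hg eps Heps.
assert (Hc := ex_derive_continuous (K := C_AbsRing) (V := C_NormedModule)
  g p (ex_intro _ l Hg)).
assert (Heps2 : 0 < eps / 2) by lra.
destruct (proj1 (filterlim_locally _ _) Hc (mkposreal _ Heps2)) as [r Hr].
exists r; split; [apply cond_pos | intros w Hw].
apply ball_half_Cmod; exact (Hr w Hw).
Qed.

Lemma R_derivable_continuous (gamma : R -> C) (t : R) :
  ex_derive (V := C_R_NormedModule) gamma t ->
  forall eps : R, 0 < eps ->
  exists r : R, 0 < r /\
    forall s : R, Rabs (s - t) < r -> Cmod (gamma s - gamma t) < eps.
Proof.
intros Hg eps Heps.
assert (Hc := ex_derive_continuous (V := C_R_NormedModule) gamma t Hg).
assert (Heps2 : 0 < eps / 2) by lra.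
destruct (proj1 (filterlim_locally _ _) Hc (mkposreal _ Heps2)) as [r Hr].
exists r; split; [apply cond_pos | intros s Hs].
apply ball_half_Cmod; exact (Hr s Hs).
Qed.

(** * The Heine-Cantor theorem *)

(** Continuity is required with respect to the whole plane around each point
    of [A], and closedness is the openness of the complement, so that every
    point of the plane has a gauge radius: one on which [f] oscillates little if
    the point is in [A], one avoiding [A] otherwise.  A common lower bound for
    the radii used to cover a square around [A] is the modulus sought. *)
Lemma Heine_Cmod (A : C -> Prop) (f : C -> C) :
  bounded_set A ->
  (forall p : C, ~ A p ->
     exists r : R, 0 < r /\ forall w : C, Cmod (w - p) < r -> ~ A w) ->
  (forall (p : C) (eps : R), A p -> 0 < eps ->
     exists r : R, 0 < r /\
       forall w : C, Cmod (w - p) < r -> Cmod (f w - f p) < eps) ->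
  uniformly_continuous_on A f.
Proof.
intros [M HM] Hclosed Hcont eps Heps.
(* The Lebesgue-number lemma locates [z] in a square of half-side [r] around the
   centre [p], hence at distance less than [2 r]; then [w] is at distance less
   than [3 r], since [d <= r]. *)
assert (gauge : forall p : C, exists r : posreal, forall z w : C,
  Cmod (z - p) < 2 * r -> Cmod (w - p) < 3 * r -> A z -> A w ->
  Cmod (f z - f w) < eps).
{ intros p; destruct (classic (A p)) as [Hp | Hp].
  - destruct (Hcont p (eps / 2) Hp ltac:(lra)) as [r [Hr Hf]].
    exists (mkposreal (r / 3) ltac:(lra)); simpl; intros z w Hz Hw _ _.
    assert (Hfz := Hf z ltac:(lra)); assert (Hfw := Hf w ltac:(lra)).
    rewrite Cmod_minus_sym in Hfw.
    pose proof (Cmod_minus_triangle (f z) (f p) (f w)); lra.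
  - destruct (Hclosed p Hp) as [r [Hr HA]].
    exists (mkposreal (r / 3) ltac:(lra)); simpl; intros z w Hz _ HAz _.
    destruct (HA z ltac:(lra) HAz). }
destruct (choice _ gauge) as [delta Hdelta].
destruct (compactness_value_2d (- M) M (- M) M (fun x y => delta (x, y)))
  as [d Hd].
exists d; split; [apply cond_pos | intros z w Hz Hw Hzw].
assert (HMz := Rmax_Cmod z); assert (HMz' := HM z Hz).
assert (Hx := Rmax_l (Rabs (fst z)) (Rabs (snd z))).
assert (Hy := Rmax_r (Rabs (fst z)) (Rabs (snd z))).
destruct (NNPP _ (Hd (fst z) (snd z) ltac:(apply Rabs_le_between; lra)
  ltac:(apply Rabs_le_between; lra))) as (u & v & _ & _ & Hu & Hv & Hduv).
assert (Hzp : Cmod (z - (u, v)) < 2 * delta (u, v)).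
{ eapply Rle_lt_trans; [apply Cmod_le_components |]. simpl.
  unfold Rminus in *; lra. }
apply (Hdelta (u, v)); auto.
pose proof (Cmod_minus_triangle w z (u, v)).
rewrite Cmod_minus_sym in Hzw; lra.
Qed.

(** * Connectedness of star-shaped sets *)

Definition star_shaped (z : C) (A : C -> Prop) : Prop :=
  forall (w : C) (t : R), A w -> 0 <= t <= 1 -> A (z + t * (w - z))%C.

(** Moving from [z] towards [w], consider the supremum [m] of the times up to
    which the segment stays in [U].  The point at time [m] cannot be in [V],
    which would then meet [U] just before [m]; so it is in [U], which then
    reaches beyond [m] unless [m = 1]. *)
Lemma segment_trapped (U V : C -> Prop) (z w : C) :
  open (T := C_UniformSpace) U -> open (T := C_UniformSpace) V ->
  (forall t : R, 0 <= t <= 1 ->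
     U (z + t * (w - z))%C \/ V (z + t * (w - z))%C) ->
  (forall t : R, 0 <= t <= 1 ->
     ~ (U (z + t * (w - z))%C /\ V (z + t * (w - z))%C)) ->
  U z -> U w.
Proof.
set (p := fun t : R => (z + t * (w - z))%C).
intros HU HV Hcov Hdisj Hz.
assert (near : forall (W : C -> Prop) (t : R),
  open (T := C_UniformSpace) W -> W (p t) ->
  exists e : R, 0 < e /\ forall s : R, Rabs (s - t) < e -> W (p s)).
{ intros W t HW Ht; destruct (open_disc W (p t) HW Ht) as [r [Hr HWr]].
  pose proof (Cmod_ge_0 (w - z)) as HL.
  exists (r / (1 + Cmod (w - z))); split; [apply Rdiv_lt_0_compat; lra |].
  intros s Hs; apply HWr; unfold p.
  replace (z + s * (w - z) - (z + t * (w - z)))%C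
    with (RtoC (s - t) * (w - z))%C by (rewrite RtoC_minus; ring).
  rewrite Cmod_mult, Cmod_R.
  apply Rlt_div_r in Hs; [| lra].
  pose proof (Rabs_pos (s - t)); nra. }
assert (p0 : p 0 = z) by (unfold p; ring).
assert (p1 : p 1 = w) by (unfold p; ring).
set (E := fun t : R => 0 <= t <= 1 /\ forall s : R, 0 <= s <= t -> U (p s)).
assert (E0 : E 0).
{ split; [lra |]; intros s Hs; replace s with 0 by lra; now rewrite p0. }
destruct (completeness E) as [m [Hub Hlub]].
{ exists 1; intros t [Ht _]; lra. }
{ now exists 0. }
assert (Hm : 0 <= m <= 1).
{ split; [now apply Hub | apply Hlub; intros t [Ht _]; lra]. }
assert (approach : forall e : R, 0 < e -> exists t : R, E t /\ m - e < t).
{ intros e He; apply NNPP; intros Hn.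
  assert (m <= m - e); [| lra].
  apply Hlub; intros t Ht; apply Rnot_lt_le; intros Hlt; apply Hn.
  now exists t. }
destruct (Hcov m Hm) as [HmU | HmV].
- destruct (near U m HU HmU) as [e [He HUe]].
  destruct (approach e He) as [t [[Ht HtU] Hmt]].
  assert (Em : E (Rmin 1 (m + e / 2))).
  { split.
    - split; [apply Rmin_glb; lra | apply Rmin_l].
    - intros s [Hs0 Hs].
      pose proof (Rmin_r 1 (m + e / 2)).
      destruct (Rle_or_lt s t); [apply HtU; lra |].
      apply HUe; apply Rabs_lt_between; lra. }
  assert (Hle := Hub _ Em); rewrite <- p1.
  destruct Em as [_ Em]; apply Em; split; [lra |].
  apply Rmin_glb; [lra |].
  revert Hle; unfold Rmin; destruct (Rle_dec 1 (m + e / 2)); lra.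
- destruct (near V m HV HmV) as [e [He HVe]].
  destruct (approach e He) as [t [Et Hmt]].
  pose proof (Hub t Et); destruct Et as [Ht HtU].
  destruct (Hdisj t Ht); split; [apply HtU; lra |].
  apply HVe; apply Rabs_lt_between; lra.
Qed.

Lemma star_shaped_connected (z : C) (A : C -> Prop) :
  A z -> star_shaped z A -> connected_set A.
Proof.
intros Az Hstar U V HU HV Hcov Hdisj.
destruct (Hcov z Az) as [Hz | Hz]; [left | right]; intros w Aw.
- apply (segment_trapped U V z w); auto.
- apply (segment_trapped V U z w); auto.
  + intros t Ht; destruct (Hcov _ (Hstar w t Aw Ht)); auto.
  + intros t Ht [H1 H2]; apply (Hdisj _ (Hstar w t Aw Ht)); auto.
Qed.

Lemma connected_union (A B : C -> Prop) (z : C) :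
  connected_set A -> connected_set B -> A z -> B z ->
  connected_set (fun u => A u \/ B u).
Proof.
intros HA HB Az Bz U V HU HV Hcov Hdisj.
destruct (HA U V HU HV) as [HAU | HAV]; auto;
destruct (HB U V HU HV) as [HBU | HBV]; auto.
- left; intros u [Au | Bu]; auto.
- destruct (Hdisj z (or_introl Az)); auto.
- destruct (Hdisj z (or_introl Az)); auto.
- right; intros u [Au | Bu]; auto.
Qed.

Lemma disc_star_shaped (z : C) (r : R) :
  star_shaped z (fun w => Cmod (w - z) < r).
Proof.
intros w t Hw Ht.
replace (z + t * (w - z) - z)%C with (RtoC t * (w - z))%C by ring.
rewrite Cmod_mult, Cmod_R, Rabs_pos_eq by lra.
pose proof (Cmod_ge_0 (w - z)); nra.
Qed.

(** * Components *)

(** A connected set through the centre of the disc, enlarged by the disc, is a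
    connected set through any other of its points. *)
Lemma component_disc_incl (S : C -> Prop) (p w u : C) (r : R) :
  (forall v : C, Cmod (v - p) < r -> S v) ->
  Cmod (w - p) < r -> component S p u -> component S w u.
Proof.
intros HS Hw (A & HA & HAS & Ap & Au).
assert (Hp : Cmod (p - p) < r).
{ rewrite Cmod_minus_diag; pose proof (Cmod_ge_0 (w - p)); lra. }
exists (fun v => A v \/ Cmod (v - p) < r); repeat split; auto.
- apply (connected_union _ _ p); auto.
  apply (star_shaped_connected p); [exact Hp | apply disc_star_shaped].
- intros v [Av | Hv]; auto.
Qed.

(** The ray from [z] away from the origin never comes back to the disc. *)
Lemma component_outside_disc_unbounded (S : C -> Prop) (M : R) (z : C) :
  0 <= M -> (forall u : C, M < Cmod u -> S u) -> M < Cmod z ->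
  ~ bounded_set (component S z).
Proof.
intros HM HS Hz [M' HM'].
set (ray := fun u : C => exists r : R, 1 <= r /\ u = (RtoC r * z)%C).
assert (Hray : connected_set ray).
{ apply (star_shaped_connected z).
  - exists 1; split; [lra | ring].
  - intros u t [r [Hr ->]] Ht; exists (1 + t * (r - 1)); split; [nra |].
    rewrite RtoC_plus, RtoC_mult, RtoC_minus; ring. }
assert (HrS : forall u, ray u -> S u).
{ intros u [r [Hr ->]]; apply HS.
  rewrite Cmod_mult, Cmod_R, Rabs_pos_eq by lra; nra. }
(* With this factor the point [r z] has modulus [Cmod z + Rabs M'], beyond the
   supposed bound [M']. *)
set (r := 1 + Rabs M' / Cmod z).
assert (Hr : 0 <= Rabs M' / Cmod z).
{ apply Rdiv_le_0_compat; [apply Rabs_pos | lra]. }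
assert (Hfar : Cmod (RtoC r * z) <= M').
{ apply HM'; exists ray; repeat split; auto.
  - exists 1; split; [lra | ring].
  - exists r; split; [unfold r; lra | reflexivity]. }
rewrite Cmod_mult, Cmod_R, Rabs_pos_eq in Hfar by (unfold r; lra).
unfold r in Hfar.
replace ((1 + Rabs M' / Cmod z) * Cmod z) with (Cmod z + Rabs M') in Hfar
  by (field; lra).
pose proof (Rle_abs M'); lra.
Qed.

(** * The interior together with the curve is compact *)

(** Reduces extrema over the whole line to the compact interval [0, T]. *)
Lemma periodic_range (T : R) (gamma : R -> C) :
  0 < T -> (forall t : R, gamma (t + T) = gamma t) ->
  forall t : R, exists s : R, 0 <= s <= T /\ gamma s = gamma t.
Proof.
intros HT Hper t.
assert (HZ : forall (k : Z) (s : R), gamma (s + IZR k * T) = gamma s).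
{ intros k; induction k as [| k IH | k IH] using Z.peano_ind; intros s.
  - f_equal; ring.
  - rewrite <- (IH s), <- (Hper (s + IZR k * T)), succ_IZR; f_equal; ring.
  - rewrite <- (IH s), <- (Hper (s + IZR (Z.pred k) * T)).
    unfold Z.pred; rewrite plus_IZR; f_equal; ring. }
destruct (floor_ex (t / T)) as [k Hk].
exists (t + IZR (- k) * T); split; [| apply HZ].
assert (Ht : t = t / T * T) by (field; lra).
rewrite opp_IZR; nra.
Qed.

Lemma curve_distance_continuous (T : R) (gamma : R -> C) (z : C) :
  smooth_simple_closed_curve T gamma ->
  forall t : R, continuity_pt (fun s => Cmod (gamma s - z)) t.
Proof.
intros Hc t eps Heps.
destruct (R_derivable_continuous gamma t (curve_derivable T gamma Hc t)
  eps Heps) as [r [Hr Hg]].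
exists r; split; [exact Hr | intros s [_ Hs]]; simpl in *.
unfold Rdist in *; specialize (Hg s Hs).
pose proof (Cmod_minus_triangle (gamma s) (gamma t) z).
pose proof (Cmod_minus_triangle (gamma t) (gamma s) z) as H'.
rewrite (Cmod_minus_sym (gamma t) (gamma s)) in H'.
apply Rabs_lt_between; lra.
Qed.

Lemma curve_bounded (T : R) (gamma : R -> C) :
  smooth_simple_closed_curve T gamma ->
  exists M : R, forall t : R, Cmod (gamma t) <= M.
Proof.
intros Hc; pose proof (curve_period_pos T gamma Hc) as HT.
destruct (continuity_ab_maj (fun s => Cmod (gamma s - 0)) 0 T ltac:(lra))
  as [m [Hm _]].
{ intros t _; now apply (curve_distance_continuous T). }
exists (Cmod (gamma m - 0)); intros t.
destruct (periodic_range T gamma HT (curve_periodic T gamma Hc) t)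
  as [s [Hs <-]].
replace (gamma s) with (gamma s - 0)%C by ring; auto.
Qed.

(** The distance to [z] attains its minimum on one period; it is positive if
    [z] is off the curve. *)
Lemma off_curve_open (T : R) (gamma : R -> C) (z : C) :
  smooth_simple_closed_curve T gamma -> off_curve gamma z ->
  exists r : R, 0 < r /\ forall w : C, Cmod (w - z) < r -> off_curve gamma w.
Proof.
intros Hc Hz; pose proof (curve_period_pos T gamma Hc) as HT.
destruct (continuity_ab_min (fun s => Cmod (gamma s - z)) 0 T ltac:(lra))
  as [m [Hm _]].
{ intros t _; now apply (curve_distance_continuous T). }
exists (Cmod (gamma m - z)); split.
- apply Cmod_gt_0; intros H; apply Hz; exists m.
  replace (gamma m) with (gamma m - z + z)%C by ring; rewrite H; ring.
- intros w Hw [t Ht].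
  destruct (periodic_range T gamma HT (curve_periodic T gamma Hc) t)
    as [s [Hs Hst]].
  rewrite <- Ht, <- Hst in Hw; specialize (Hm s Hs); lra.
Qed.

(** A disc containing the curve contains the interior, for the components of
    the points outside it are unbounded. *)
Lemma interior_or_curve_bounded (T : R) (gamma : R -> C) :
  smooth_simple_closed_curve T gamma ->
  bounded_set (fun z => curve_interior gamma z \/ on_curve gamma z).
Proof.
intros Hc; destruct (curve_bounded T gamma Hc) as [M HM].
exists M; intros z [[_ Hz] | [t <-]]; [| apply HM].
apply Rnot_lt_le; intros Hlt.
apply (component_outside_disc_unbounded (off_curve gamma) M z); auto.
- pose proof (Cmod_ge_0 (gamma 0)); pose proof (HM 0); lra.
- intros u Hu [t Ht]; pose proof (HM t) as Ht'; rewrite Ht in Ht'; lra.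
Qed.

(** Around a point in neither set there is a disc off the curve; if one of its
    points had a bounded component, so would the centre. *)
Lemma interior_or_curve_closed (T : R) (gamma : R -> C) (p : C) :
  smooth_simple_closed_curve T gamma ->
  ~ (curve_interior gamma p \/ on_curve gamma p) ->
  exists r : R, 0 < r /\ forall w : C, Cmod (w - p) < r ->
    ~ (curve_interior gamma w \/ on_curve gamma w).
Proof.
intros Hc Hp.
assert (Hoff : off_curve gamma p) by (intros H; apply Hp; now right).
destruct (off_curve_open T gamma p Hc Hoff) as [r [Hr Hdisc]].
exists r; split; [exact Hr |].
intros w Hw [[_ [M HM]] | Hon]; [| now apply (Hdisc w Hw)].
apply Hp; left; split; [exact Hoff |].
exists M; intros u Hu; apply HM.
now apply (component_disc_incl _ p w u r).
Qed.

(** * Continuity up to the curve and conclusion *)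

Lemma generalized_cauchy_continuous (gamma : R -> C) (f : C -> C) (p : C) :
  generalized_cauchy_function gamma f ->
  curve_interior gamma p \/ on_curve gamma p ->
  forall eps : R, 0 < eps ->
  exists r : R, 0 < r /\
    forall w : C, Cmod (w - p) < r -> Cmod (f w - f p) < eps.
Proof.
intros (n & N & Hn & _ & HN & g & Hg0 & Hg & _) Hp eps Heps.
destruct (C_derivable_continuous (g O) p (g 1%nat p)) with (eps := eps)
  as [r [Hr Hw]]; auto.
- apply Hg; [exact Hn | destruct Hp; auto].
- exists r; split; [exact Hr | intros w; rewrite <- !Hg0; apply Hw].
Qed.

Theorem theorem7 (T : R) (gamma : R -> C) (f : C -> C)
  (Hcurve : smooth_simple_closed_curve T gamma)
  (Horient : counterclockwise T gamma)
  (Hf : generalized_cauchy_function gamma f)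
  (Hint : forall z : C, curve_interior gamma z ->
            cauchy_integral T gamma f z = f z)
  (Hext : forall z : C, curve_exterior gamma z ->
            cauchy_integral T gamma f z = RtoC 0) :
  uniformly_continuous_on
    (fun z => curve_interior gamma z \/ on_curve gamma z) f.
Proof.
apply Heine_Cmod.
- now apply (interior_or_curve_bounded T).
- intros p; now apply (interior_or_curve_closed T).
- intros p eps Hp; now apply (generalized_cauchy_continuous gamma).
Qed.
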